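(* For every odd prime $p$ and every $L\ge 0$, \[a_{\mathrm{carry}}(L)=p^L\,a_{\mathrm{dbl}}(L).\] For $p=2$ this scaling law fails.
   Context: Fix a base $p\ge 2$. Carry in addition: for a pair of digit strings $(a_1,\dots,a_L),(b_1,\dots,b_L)\in\{0,\dots,p-1\}^L$ (least significant digit first), set $\sigma_0=0$ and $\sigma_j=\lfloor (a_j+b_j+\sigma_{j-1})/p\rfloor$. The pair is cascade-free if there is no $j$ with $a_j+b_j=p-1$ and $\sigma_{j-1}=1$; $a_{\mathrm{carry}}(L)$ is the number of cascade-free pairs (out of $p^{2L}$). Carry in doubling: for a digit string $(d_1,\dots,d_L)\in\{0,\dots,p-1\}^L$ (the base-$p$ digits of $m\in[0,p^L)$), set $\sigma_0=0$, $\sigma_j=\lfloor(2d_j+\sigma_{j-1})/p\rfloor$; it is cascade-free if there is no $j$ with $2d_j=p-1$ and $\sigma_{j-1}=1$; $a_{\mathrm{dbl}}(L)$ is the number of cascade-free strings. *)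

(* Defs.v *)
From mathcomp Require Import all_boot.

Set Implicit Arguments.
Unset Strict Implicit.
Unset Printing Implicit Defensive.

(* Digit strings are [L.-tuple 'I_p], least significant digit first; the
   1-based digit of index j is the entry of index j - 1 of the tuple.
   Addition and doubling differ only in the column sums (a_j + b_j, resp.
   2 d_j) fed to the carry recursion, so the carry is defined from the sequence
   [c] of column sums: [carry p c j] is sigma_j, for 0 <= j <= size c. *)
Fixpoint carry (p : nat) (c : seq nat) (j : nat) : nat :=
  if j is i.+1 then (nth 0 c i + carry p c i) %/ p else 0.

(* With the 0-based column i = j - 1, the incoming carry sigma_(j-1) is
   [carry p c i]. *)
Definition cascade_free (p : nat) (c : seq nat) : bool :=
  ~~ [exists i : 'I_(size c), (nth 0 c i == p - 1) && (carry p c i == 1)].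

Definition add_columns (p L : nat) (a b : L.-tuple 'I_p) : seq nat :=
  [seq (nat_of_ord x.1 + nat_of_ord x.2)%N | x <- zip a b].

Definition dbl_columns (p L : nat) (d : L.-tuple 'I_p) : seq nat :=
  [seq (2 * nat_of_ord x)%N | x <- d].

Definition a_carry (p L : nat) : nat :=
  #|[set ab : L.-tuple 'I_p * L.-tuple 'I_p
      | cascade_free p (add_columns ab.1 ab.2)]|.

Definition a_dbl (p L : nat) : nat :=
  #|[set d : L.-tuple 'I_p | cascade_free p (dbl_columns d)]|.

(* Main.v *)
(** Whether a string of column sums is cascade-free depends only on how each sum
    compares with p - 1: below kills the carry, above creates one, and equality
    propagates it. For odd p, each of the three outcomes is exactly p times as
    frequent among the p^2 digit pairs as among the p digits: the reflection
    d |-> p - 1 - d exchanges "below" and "above", while equality holds for p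
    pairs and, p being odd, for one digit. For p = 2 the sum 2d never equals 1,
    and at L = 2 one gets 14 against 2^2 * 4 = 16. *)

Require Import Defs.
From mathcomp Require Import all_boot.
From mathcomp Require Import zify.

Set Implicit Arguments.
Unset Strict Implicit.
Unset Printing Implicit Defensive.

(** The incoming carry [s] is a parameter so that induction can peel off the least significant
    column and pass its carry on to the rest. *)
Fixpoint cascade_free_from (p s : nat) (c : seq nat) : bool :=
  if c is x :: c' then
    ~~ ((x == p - 1) && (s == 1)) && cascade_free_from p ((x + s) %/ p) c'
  else true.

Fixpoint carry_from (p s : nat) (c : seq nat) (j : nat) : nat :=
  if j is i.+1 then (nth 0 c i + carry_from p s c i) %/ p else s.

Lemma carry_from0 p c j : carry_from p 0 c j = carry p c j.
Proof. by elim: j => //= j ->. Qed.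

Lemma carry_from_cons p s x c j :
  carry_from p s (x :: c) j.+1 = carry_from p ((x + s) %/ p) c j.
Proof. by elim: j => //= j <-. Qed.

Lemma cascade_free_fromP p s c :
  reflect (forall i, i < size c ->
             ~~ ((nth 0 c i == p - 1) && (carry_from p s c i == 1)))
          (cascade_free_from p s c).
Proof.
elim: c s => [|x c IHc] s; first by left.
apply: (iffP andP) => [[ok_x /IHc ok_c] [|i] lt_i | ok].
- exact: ok_x.
- by rewrite carry_from_cons; apply: ok_c.
split; first exact: (ok 0).
by apply/IHc => i lt_i; have := ok i.+1 lt_i; rewrite carry_from_cons.
Qed.

Lemma cascade_freeE p c : cascade_free p c = cascade_free_from p 0 c.
Proof.
rewrite /cascade_free negb_exists.
apply/forallP/cascade_free_fromP => [ok i lt_i | ok i].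
  by rewrite carry_from0; apply: (ok (Ordinal lt_i)).
by rewrite -carry_from0; apply: ok.
Qed.

Section Counting.

Variables (p : nat) (D : finType) (f : D -> nat).

(** Leaving the alphabet [D] and the column sum [f] abstract lets digit pairs and single digits obey
    one and the same recursion. *)
Definition nb_cascade_free (L s : nat) : nat :=
  #|[set t : L.-tuple D | cascade_free_from p s (map f t)]|.

Lemma nb_cascade_free0 s : nb_cascade_free 0 s = 1.
Proof.
rewrite /nb_cascade_free -[RHS](expn0 #|D|) -card_tuple -cardsT.
by apply: eq_card => t; rewrite !inE tuple0.
Qed.

Lemma nb_cascade_freeS L s :
  nb_cascade_free L.+1 s =
  \sum_d ~~ ((f d == p - 1) && (s == 1)) * nb_cascade_free L ((f d + s) %/ p).
Proof.
rewrite /nb_cascade_free -sum1_card big_mkcond /=.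
(* Split each tuple into its head, the least significant digit, and its tail. *)
rewrite (reindex (fun x : D * L.-tuple D => [tuple of x.1 :: x.2])) /=; last first.
  exists (fun t => (thead t, [tuple of behead t])) => [[d t] _ | t _].
    by rewrite /= theadE; congr pair; apply: val_inj.
  by rewrite [RHS]tuple_eta.
rewrite -(pair_bigA _ (fun d (t : L.-tuple D) =>
  if [tuple of d :: t] \in [set t : L.+1.-tuple D | cascade_free_from p s (map f t)]
  then 1 else 0)) /=.
apply: eq_bigr => d _; rewrite -sum1_card [in RHS]big_mkcond big_distrr /=.
apply: eq_bigr => t _; rewrite !inE /=.
by do 2 case: ifP => //=; case: (~~ _).
Qed.

Definition nb_below := #|[pred d | f d < p - 1]|.
Definition nb_equal := #|[pred d | f d == p - 1]|.
Definition nb_above := #|[pred d | p - 1 < f d]|.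

Lemma sum_by_column_type (F : D -> nat) A B C :
  (forall d, F d = if f d < p - 1 then A else if f d == p - 1 then B else C) ->
  \sum_d F d = nb_below * A + nb_equal * B + nb_above * C.
Proof.
move=> eqF; rewrite /nb_below /nb_equal /nb_above -!sum_nat_const.
rewrite !(big_mkcond (fun d => d \in _)) /= -!big_split /=.
by apply: eq_bigr => d _; rewrite eqF !inE; case: ltngtP => _; lia.
Qed.

Lemma nb_column_types : nb_below + nb_equal + nb_above = #|D|.
Proof.
rewrite -[RHS]sum1_card (eq_bigl predT) //.
rewrite (@sum_by_column_type _ 1 1 1) ?muln1 // => d.
by case: ltngtP.
Qed.

(** The values at [d] and [r d] lie symmetrically about [p - 1], so [r] maps the columns above
    bijectively onto those below. *)
Lemma nb_above_reflect (r : D -> D) :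
  involutive r -> (forall d, f d + f (r d) = (p - 1).*2) -> nb_above = nb_below.
Proof.
move=> rK f_r; rewrite /nb_above /nb_below -(card_image (can_inj rK)).
apply: eq_card => d; rewrite !inE -[d in LHS]rK (mem_image (can_inj rK)) !inE.
by have := f_r d; lia.
Qed.

Hypothesis p_gt0 : 0 < p.
Hypothesis f_le : forall d, f d <= (p - 1).*2.

(** The bounds give [x + s < 2 * p], so carries never exceed 1. A carry of 1 cannot lift a sum below
    [p - 1] up to [p], and a sum above [p - 1] reaches [p] unaided. *)
Lemma next_carry x s : x <= (p - 1).*2 -> s <= 1 ->
  (x + s) %/ p = if x < p - 1 then 0 else if x == p - 1 then s else 1.
Proof.
move=> x_le s_le; case: ltngtP => x_p.
- by rewrite divn_small //; lia.
- have -> : x + s = 1 * p + (x + s - p) by lia.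
  by rewrite divnMDl // divn_small //; lia.
- case: s s_le => [|[|//]] _; first by rewrite divn_small //; lia.
  by rewrite x_p subnK // divnn p_gt0.
Qed.

(** The factor [(s == 0)] removes the forbidden case: a column equal to [p - 1] survives only with
    incoming carry 0, which it passes on. *)
Lemma nb_cascade_freeS_types L s : s <= 1 ->
  nb_cascade_free L.+1 s = nb_below * nb_cascade_free L 0
    + nb_equal * ((s == 0) * nb_cascade_free L 0)
    + nb_above * nb_cascade_free L 1.
Proof.
move=> s_le; rewrite nb_cascade_freeS; apply: sum_by_column_type => d.
rewrite next_carry //; case: ltngtP => _ /=; rewrite ?mul1n //.
by case: s s_le => [|[|//]] _; rewrite ?mul1n.
Qed.

End Counting.

(** The recursion is linear in the three column counts, so each column contributes one factor [k],
    for both incoming carries at once. *)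
Lemma nb_cascade_free_scale p k (D E : finType) (f : D -> nat) (g : E -> nat) L s :
  0 < p -> (forall d, f d <= (p - 1).*2) -> (forall e, g e <= (p - 1).*2) ->
  nb_below p f = k * nb_below p g -> nb_equal p f = k * nb_equal p g ->
  nb_above p f = k * nb_above p g -> s <= 1 ->
  nb_cascade_free p f L s = k ^ L * nb_cascade_free p g L s.
Proof.
move=> p_gt0 f_le g_le below equal above.
elim: L s => [|L IHL] s s_le; first by rewrite !nb_cascade_free0.
rewrite !nb_cascade_freeS_types // !IHL // below equal above expnS.
by rewrite !mulnDr; congr (_ + _ + _); nia.
Qed.

Definition add_column p (x : 'I_p * 'I_p) : nat := x.1 + x.2.
Definition dbl_column p (d : 'I_p) : nat := 2 * d.

Lemma a_carryE p L : a_carry p L = nb_cascade_free p (@add_column p) L 0.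
Proof.
pose zipt (ab : L.-tuple 'I_p * L.-tuple 'I_p) := [tuple of zip ab.1 ab.2].
pose unzipt (t : L.-tuple ('I_p * 'I_p)) :=
  ([tuple of map fst t], [tuple of map snd t]).
have ziptK : cancel zipt unzipt.
  move=> [a b]; congr pair; apply: val_inj => /=.
    by rewrite -/(unzip1 _) unzip1_zip // !size_tuple.
  by rewrite -/(unzip2 _) unzip2_zip // !size_tuple.
have unziptK : cancel unzipt zipt.
  by move=> t; apply: val_inj; apply: zip_unzip.
rewrite /a_carry /nb_cascade_free.
rewrite -(on_card_preimset (f := zipt)); last first.
  by apply: onW_bij; exists unzipt.
by apply: eq_card => ab; rewrite !inE cascade_freeE.
Qed.

Lemma a_dblE p L : a_dbl p L = nb_cascade_free p (@dbl_column p) L 0.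
Proof. by apply: eq_card => d; rewrite !inE cascade_freeE. Qed.

Lemma add_column_le p x : @add_column p x <= (p - 1).*2.
Proof. by rewrite /add_column; have := ltn_ord x.1; have := ltn_ord x.2; lia. Qed.

Lemma dbl_column_le p d : @dbl_column p d <= (p - 1).*2.
Proof. by rewrite /dbl_column; have := ltn_ord d; lia. Qed.

Lemma nb_above_add p : nb_above p (@add_column p) = nb_below p (@add_column p).
Proof.
apply: (@nb_above_reflect _ _ _ (fun x => (rev_ord x.1, rev_ord x.2))) => [[a b]|[a b]].
  by rewrite /= !rev_ordK.
by rewrite /add_column /=; have := ltn_ord a; have := ltn_ord b; lia.
Qed.

Lemma nb_above_dbl p : nb_above p (@dbl_column p) = nb_below p (@dbl_column p).
Proof.
apply: (nb_above_reflect (@rev_ordK p)) => d.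
by rewrite /dbl_column /=; have := ltn_ord d; lia.
Qed.

Lemma nb_equal_add p : nb_equal p (@add_column p) = p.
Proof.
(* The pairs with sum [p - 1] form the graph of the reflection [rev_ord]. *)
have inj : injective (fun a : 'I_p => (a, rev_ord a)) by move=> a b [].
rewrite -[RHS]card_ord -(card_codom inj).
apply: eq_card => -[a b]; rewrite inE /add_column /=.
apply/eqP/codomP => [ab | [c [-> ->]] /=]; last by have := ltn_ord c; lia.
by exists a; congr pair; apply: val_inj => /=; lia.
Qed.

Lemma nb_equal_dbl p : odd p -> nb_equal p (@dbl_column p) = 1.
Proof.
(* For odd [p], [p./2] is [(p - 1) / 2], the only solution of [2 * d = p - 1]. *)
move=> p_odd; have half_lt : p./2 < p by lia.
rewrite -(card1 (Ordinal half_lt)); apply: eq_card => d.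
by rewrite !inE -val_eqE /dbl_column /=; lia.
Qed.

(** Write B and b for the counts below, for pairs and for digits. By reflection, 2B + p = p^2 and 2b
    + 1 = p, hence 2B = p(p - 1) = 2pb. *)
Lemma nb_below_scale p : odd p ->
  nb_below p (@add_column p) = p * nb_below p (@dbl_column p).
Proof.
move=> p_odd.
have := nb_column_types p (@add_column p); have := nb_column_types p (@dbl_column p).
rewrite nb_above_add nb_above_dbl nb_equal_add nb_equal_dbl // card_prod card_ord.
by nia.
Qed.

Lemma a_carry_odd p L : odd p -> a_carry p L = p ^ L * a_dbl p L.
Proof.
move=> p_odd; rewrite a_carryE a_dblE; apply: nb_cascade_free_scale => //.
- exact: odd_gt0.
- exact: add_column_le.
- exact: dbl_column_le.
- exact: nb_below_scale.
- by rewrite nb_equal_add nb_equal_dbl // muln1.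
- by rewrite nb_above_add nb_above_dbl nb_below_scale.
Qed.

Lemma a_carry2_2 : a_carry 2 2 = 14.
Proof.
(* The counts below, equal, above are 1, 2, 1. Length 1 gives 4 for carry 0 and 2 for carry 1, so
   length 2 gives 4 + 2 * 4 + 2 = 14. *)
have types := nb_column_types 2 (@add_column 2).
rewrite nb_above_add nb_equal_add card_prod card_ord in types.
rewrite a_carryE !nb_cascade_freeS_types ?nb_cascade_free0 //;
  try exact: add_column_le.
by rewrite nb_above_add nb_equal_add /=; lia.
Qed.

Lemma a_dbl2_2 : a_dbl 2 2 = 4.
Proof.
have equal0 : nb_equal 2 (@dbl_column 2) = 0.
  by apply: eq_card0 => d; rewrite !inE /dbl_column; lia.
have types := nb_column_types 2 (@dbl_column 2).
rewrite nb_above_dbl equal0 card_ord in types.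
rewrite a_dblE !nb_cascade_freeS_types ?nb_cascade_free0 //;
  try exact: dbl_column_le.
by rewrite nb_above_dbl equal0 /=; lia.
Qed.

Theorem theorem5p2 :
  (forall p L : nat, prime p -> odd p ->
     a_carry p L = (p ^ L * a_dbl p L)%N)
  /\ ~ (forall L : nat, a_carry 2 L = (2 ^ L * a_dbl 2 L)%N).
Proof.
(* Length 2 is the first failure for base 2: lengths 0 and 1 give 1 = 1 and 4 = 2 * 2. *)
split=> [p L _ | /(_ 2)]; first exact: a_carry_odd.
by rewrite a_carry2_2 a_dbl2_2.
Qed.
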